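(* $\mathrm{SCM}(5,2;4;7,2,4)=\mathrm{RE}$. That is, a language is recursively enumerable if and only if it is generated by an SCM grammar with all of the following properties: - degree $(5,2)$; - at most $4$ nonterminals; - at most $7$ conditional matrices; - all matrices of length at most $2$; - at most $4$ non-simple matrices.
   Context: A semi-conditional matrix (SCM) grammar is a quadruple $G=(V,T,M,S)$ with the following components. - $V$ is a finite alphabet and $T\subsetneq V$ is the set of terminals. - $N=V\setminus T$ is the set of nonterminals and $S\in N$ is the start symbol. - $M$ is a finite set of matrices of the form $r=[(A_1\to x_1),\dots,(A_\ell\to x_\ell),P,F]$, where $\ell\ge 1$, $A_k\in N$, $x_k\in V^*$, and $P,F\in V^+\cup\{\emptyset\}$. Here $\emptyset\notin V$ is a special symbol meaning that the condition is absent, and $|\emptyset|=0$. The number $\ell$ is the length of $r$. A matrix is classified as follows: - unconditional if $P=F=\emptyset$, and conditional otherwise; - simple if at least one of $P,F$ equals $\emptyset$, and non-simple if both $P\neq\emptyset$ and $F\neq\emptyset$. For $x,y\in V^*$ we write $x\Rightarrow_r y$ iff all of the following hold: 1. if $P\neq\emptyset$ then $P$ is a subword (factor) of $x$; 2. if $F\neq\emptyset$ then $F$ is not a subword of $x$; 3. there are words $x=y_0,y_1,\dots,y_\ell=y$ such that $y_k$ is obtained from $y_{k-1}$ by replacing one occurrence of $A_k$ by $x_k$. $\Rightarrow_G$ is the union of the relations $\Rightarrow_r$ over $r\in M$, and $L(G)=\{y\in T^*: S\Rightarrow_G^* y\}$. $G$ has degree $(i,j)$ if every matrix satisfies $|P|\le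 i$ and $|F|\le j$. $\mathrm{SCM}(i,j;n;m,\ell,s)$ denotes the family of languages $L(G)$ of SCM grammars $G$ that satisfy all of the following: - $G$ has degree $(i,j)$; - $|N|\le n$; - $G$ has at most $m$ conditional matrices; - every matrix of $G$ has length at most $\ell$; - $G$ has at most $s$ non-simple matrices. A $*$ in a parameter position means that parameter is unbounded. $\mathrm{SSCM}(i,j;n;m,\ell)=\mathrm{SCM}(i,j;n;m,\ell,0)$, i.e., all matrices are simple. $\mathrm{RE}$ is the class of recursively enumerable languages. *)

(* Defs.v *)
From Stdlib Require List.
From mathcomp Require Import all_boot.
Set Implicit Arguments. Unset Strict Implicit. Unset Printing Implicit Defensive.

Record scm_matrix (T N : finType) := SCMMatrix {
  mx_rules : seq (N * seq (T + N));
  mx_permit : option (seq (T + N));        (* P ; None = the symbol emptyset *)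
  mx_forbid : option (seq (T + N))         (* F ; None = the symbol emptyset *)
}.

Record scm_grammar (T N : finType) := SCMGrammar {
  scm_start : N;
  scm_matrices : seq (scm_matrix T N)
}.

Definition opt_size (A : Type) (o : option (seq A)) : nat :=
  if o is Some p then size p else 0.

Definition scm_matrix_wf (T N : finType) (r : scm_matrix T N) : Prop :=
  0 < size (mx_rules r) /\
  (forall p, mx_permit r = Some p -> p <> [::]) /\
  (forall f, mx_forbid r = Some f -> f <> [::]).

Definition scm_grammar_wf (T N : finType) (G : scm_grammar T N) : Prop :=
  forall r, List.In r (scm_matrices G) -> scm_matrix_wf r.

Definition rewrite_one (T N : finType) (A : N) (x y0 y1 : seq (T + N)) : Prop :=
  exists u v, y0 = u ++ inr A :: v /\ y1 = u ++ x ++ v.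

Fixpoint apply_rules (T N : finType) (rs : seq (N * seq (T + N)))
    (x y : seq (T + N)) : Prop :=
  match rs with
  | [::] => x = y
  | (A, w) :: rs' => exists z, rewrite_one A w x z /\ apply_rules rs' z y
  end.

Definition scm_apply (T N : finType) (r : scm_matrix T N) (x y : seq (T + N)) : Prop :=
  (forall p, mx_permit r = Some p -> infix p x) /\
  (forall f, mx_forbid r = Some f -> ~~ infix f x) /\
  apply_rules (mx_rules r) x y.

Definition scm_step (T N : finType) (G : scm_grammar T N) (x y : seq (T + N)) : Prop :=
  exists r, List.In r (scm_matrices G) /\ scm_apply r x y.

Inductive star (X : Type) (R : X -> X -> Prop) : X -> X -> Prop :=
  | star_refl x : star R x x
  | star_step x y z : R x y -> star R y z -> star R x z.

Definition scm_generates (T N : finType) (G : scm_grammar T N) (w : seq T) : Prop :=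
  star (scm_step G) [:: inr (scm_start G)] (map inl w).

Definition conditional (T N : finType) (r : scm_matrix T N) : bool :=
  (mx_permit r != None) || (mx_forbid r != None).

Definition non_simple (T N : finType) (r : scm_matrix T N) : bool :=
  (mx_permit r != None) && (mx_forbid r != None).

Definition SCM (i j n m l s : nat) (T : finType) (L : seq T -> Prop) : Prop :=
  exists (N : finType) (G : scm_grammar T N),
    [/\ scm_grammar_wf G /\ #|N| <= n,
        (forall r, List.In r (scm_matrices G) ->
           [/\ opt_size (mx_permit r) <= i, opt_size (mx_forbid r) <= j
              & size (mx_rules r) <= l]),
        count (@conditional T N) (scm_matrices G) <= m,
        count (@non_simple T N) (scm_matrices G) <= s
      & forall w, L w <-> scm_generates G w].

(* ---------- Recursively enumerable languages ----------
   RE = languages generated by unrestricted (type-0, phrase-structure) grammars. *)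

Record ps_grammar (T N : finType) := PSGrammar {
  ps_start : N;
  ps_rules : seq (seq (T + N) * seq (T + N))
}.

Definition ps_grammar_wf (T N : finType) (G : ps_grammar T N) : Prop :=
  forall lr, lr \in ps_rules G -> has (fun a : T + N => if a is inr _ then true else false) lr.1.

Definition ps_step (T N : finType) (G : ps_grammar T N) (x y : seq (T + N)) : Prop :=
  exists u v l r, (l, r) \in ps_rules G /\ x = u ++ l ++ v /\ y = u ++ r ++ v.

Definition ps_generates (T N : finType) (G : ps_grammar T N) (w : seq T) : Prop :=
  star (ps_step G) [:: inr (ps_start G)] (map inl w).

Definition RE (T : finType) (L : seq T -> Prop) : Prop :=
  exists (N : finType) (G : ps_grammar T N),
    ps_grammar_wf G /\ forall w, L w <-> ps_generates G w.

(* Main.v *)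
Require Import Defs.
From Stdlib Require List.
From HB Require Import structures.
From mathcomp Require Import all_boot.
From mathcomp Require Import zify.
Set Implicit Arguments. Unset Strict Implicit. Unset Printing Implicit Defensive.

(** From type-0 grammars to SCM grammars: running rules backwards, a queue
    [w $] is rotated until it becomes [S $], [$] marking the end of a pass. So
    [w] is generated iff [w $ u_1 ... u_k = v_1 ... v_k S $] for some tiles
    [(u_i, v_i)], where tile [i] reads [v_i] and writes [u_i].  Such an equation
    is checked over the nonterminals [S], [Y], [0], [1]: [S] inserts the coded
    [v_i] on its left and the reversed coded [u_i] on its right, then turns into
    [Y], around which equal bits are cancelled.  To cancel two bits they are both
    replaced by [S] while no other [S] is present, and then erased under the
    permitting context [S Y S]; this reuse of [S] saves a nonterminal, and is
    harmless because an insertion at such an [S] separates it from [Y] for good.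

    Conversely, a type-0 grammar simulates an SCM grammar with a head moving
    between two end markers; it checks a forbidding context by scanning the whole
    word with a lookahead of the length of the context. *)

(** * Reflexive-transitive closures and list membership *)

Lemma star_trans (X : Type) (R : X -> X -> Prop) x y z :
  star R x y -> star R y z -> star R x z.
Proof. by elim=> [//|a b c ab _ IH /IH]; apply: star_step. Qed.

Lemma star1 (X : Type) (R : X -> X -> Prop) x y : R x y -> star R x y.
Proof. by move=> xy; apply: (star_step xy); apply: star_refl. Qed.

Lemma In_mem (A : eqType) (x : A) (s : seq A) : List.In x s <-> x \in s.
Proof.
elim: s => [|y s IH] //=; rewrite in_cons; split.
  by case=> [->|/IH ->]; rewrite ?eqxx ?orbT.
by case/orP=> [/eqP ->|/IH]; [left|right].
Qed.

(** * The queue equation of a type-0 grammar *)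

Section Tiles.
Variables (T N : finType) (G : ps_grammar T N).
Local Notation sym := (T + N)%type.
Local Notation start := (inr (ps_start G) : sym).

(* [(l, r, c)]: the rule [l -> r] is undone in front of the symbol [c], where
   [None] is the marker [$]; taking [c] along keeps both sides nonempty. *)
Definition tile : Type := (seq sym * seq sym * option sym)%type.

Definition written (t : tile) : seq (option sym) := rcons (map Some t.1.1) t.2.
Definition read (t : tile) : seq (option sym) := rcons (map Some t.1.2) t.2.

Definition tiles : seq tile :=
  [seq (lr, c) | lr <- ([::], [::]) :: ps_rules G, c <- enum {: option sym}].

Lemma mem_tiles lr c : ((lr, c) \in tiles) = (lr \in ([::], [::]) :: ps_rules G).
Proof.
apply/allpairsP/idP => [[[lr' c'] /= [lrG _ [-> _]]] // | lrG].
by exists (lr, c); rewrite mem_enum.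
Qed.

(** The marker [None] cannot match any symbol of [map Some r], so a tile either ends before the
    marker ([c = Some s]) or ends exactly on it ([c = None]). *)
Lemma split_read (x r : seq sym) (c : option sym) y z :
  map Some x ++ None :: y = rcons (map Some r) c ++ z ->
  if c is Some s then
    exists2 x', x = r ++ s :: x' & map Some x' ++ None :: y = z
  else x = r /\ y = z.
Proof.
elim: r x => [|a r IH] [|b x] /=.
- by case=> <- ->; split.
- by case=> <- <-; exists x.
- by [].
case=> <- /IH; case: c {IH} => [s [x' -> E]|[-> ->]] //.
by exists x'.
Qed.

(* The queue [x1 $ x2] stands for the word [x2 x1], whose part [x1] is still to
   be read in the current pass. *)
Lemma tiles_sound (ts : seq tile) (x1 x2 : seq sym) :
  {subset ts <= tiles} ->
  map Some x1 ++ None :: map Some x2 ++ flatten (map written ts) =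
    flatten (map read ts) ++ [:: Some start; None] ->
  star (ps_step G) [:: start] (x2 ++ x1).
Proof.
elim: ts x1 x2 => [|[[l r] c] ts IH] x1 x2 tsG /=.
  (* With no tile left, the queue is [start $], hence [x1] is the start symbol and [x2] is empty. *)
  by case: x1 x2 => [|a [|b x1]] [|c x2] //= [->]; apply: star_refl.
have lrG : (l, r) \in ([::], [::]) :: ps_rules G.
  by rewrite -(mem_tiles _ c) tsG // mem_head.
have{}tsG : {subset ts <= tiles}.
  by move=> t tts; apply: tsG; rewrite in_cons tts orbT.
have one (u v : seq sym) : star (ps_step G) [:: start] (u ++ l ++ v) ->
    star (ps_step G) [:: start] (u ++ r ++ v).
  move: lrG; rewrite in_cons => /orP[/eqP[-> ->] //|lrG] su.
  by apply: (star_trans su); apply: star1; exists u, v, l, r.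
rewrite /written /read /= -catA => /split_read.
case: c {lrG} => [s [x' -> E]|[-> E]].
  (* The pass goes on: [r] and [s] leave the unread part, and [l] and [s] join the part already
     written. *)
  apply: one; rewrite -cat_rcons catA; apply: (IH x') => //.
  by rewrite -E map_cat map_rcons -!catA.
(* The tile consumes the marker and ends the pass: [x2 ++ l] becomes the unread part of the next
   one. *)
rewrite -[r]cats0; apply: one; rewrite cats0.
by apply: (IH _ [::]) => //; rewrite /= map_cat -catA -cat_rcons.
Qed.

(** Each derivation step from [u l v] to [u r v] puts one full pass in front of the tiles found so
    far: it reads [u r v $] and writes [u l v $], copying everything but [r]. *)
Lemma tiles_complete (x : seq sym) :
  star (ps_step G) [:: start] x ->
  exists2 ts : seq tile, {subset ts <= tiles} &
    rcons (map Some x) None ++ flatten (map written ts) =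
      flatten (map read ts) ++ [:: Some start; None].
Proof.
move=> sx.
suff: forall y, star (ps_step G) y x ->
    (exists2 ts : seq tile, {subset ts <= tiles} &
      rcons (map Some y) None ++ flatten (map written ts) =
      flatten (map read ts) ++ [:: Some start; None]) ->
    exists2 ts : seq tile, {subset ts <= tiles} &
      rcons (map Some x) None ++ flatten (map written ts) =
      flatten (map read ts) ++ [:: Some start; None].
  by move/(_ _ sx); apply; exists [::].
move=> y; elim=> {sx x y} [//|x y z [u [v [l [r [lrG [-> ->]]]]]] _ IH [ts tsG E]].
apply: IH.
pose copy c : tile := ([::], [::], c).
have copyG c : copy c \in tiles by rewrite mem_tiles mem_head.
have copyR s : flatten (map read (map copy s)) = s.
  by elim: s => //= a s ->.
have copyW s : flatten (map written (map copy s)) = s.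
  by elim: s => //= a s ->.
(* The symbol taken along by the rule tile is the first one of [v $], which is never empty. *)
case E1: (rcons (map Some v) None) => [|c s]; first by case: (v) E1.
exists ((map copy (map Some u) ++ (l, r, c) :: map copy s) ++ ts).
  move=> t; rewrite mem_cat => /orP[|/tsG //].
  rewrite mem_cat in_cons => /or3P[/mapP[? _ ->] //|/eqP -> |/mapP[? _ ->] //].
  by rewrite mem_tiles in_cons lrG orbT.
rewrite !(map_cat, flatten_cat) /= !copyR !copyW.
rewrite /read /written /= -(catA _ _ [:: Some start; None]) -E.
by rewrite !map_cat !rcons_cat !cat_rcons -E1 -!catA.
Qed.

End Tiles.
Arguments written {T N} t.
Arguments read {T N} t.

(** * Two unary codes of number sequences, with closing and with opening delimiters *)

Definition dcode (ns : seq nat) := flatten [seq rcons (nseq n true) false | n <- ns].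
Definition ccode (ns : seq nat) := flatten [seq false :: nseq n true | n <- ns].

Lemma dcode_cat s t : dcode (s ++ t) = dcode s ++ dcode t.
Proof. by rewrite /dcode map_cat flatten_cat. Qed.

Lemma ccode_cat s t : ccode (s ++ t) = ccode s ++ ccode t.
Proof. by rewrite /ccode map_cat flatten_cat. Qed.

(** The delimiter opening a block closes the block before it. The first one closes an empty block,
    which is the number 0, and the appended bit closes the last block. *)
Lemma ccode_shift ns : rcons (ccode ns) false = dcode (0 :: ns).
Proof.
elim: ns => // n ns IH.
by rewrite [ccode _]/= rcons_cat IH /dcode /= cat_rcons.
Qed.

Lemma dcode_inj : injective dcode.
Proof.
elim=> [|m s IH] [|n t] //=; first by case: n.
  by case: m.
elim: m n => [|m IHm] [|n] //= []; first by move/IH->.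
by move/IHm=> [-> ->].
Qed.

(** * Unique factorization around a distinguished symbol *)

Lemma cat_cons_uniq (A : Type) (a : pred A) (p q u v : seq A) x y :
  ~~ has a p -> ~~ has a q -> a x ->
  u ++ x :: v = p ++ y :: q -> [/\ u = p, x = y & v = q].
Proof.
elim: u p => [|c u IH] [|d p] //= pa qa xa.
- by case=> -> ->.
- by case=> xd _; rewrite -xd xa in pa.
- by case=> _ qE; rewrite -qE has_cat /= xa orbT in qa.
by move: pa; rewrite negb_or => /andP[_ pa] [-> /(IH _ pa qa xa)[-> -> ->]].
Qed.

Lemma cat_cons_injl (A : eqType) (x : A) (p q u v : seq A) :
  x \notin p -> x \notin u -> u ++ x :: v = p ++ x :: q -> v = q.
Proof.
elim: u p => [|c u IH] [|d p] //=; rewrite ?in_cons ?negb_or.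
- by move=> _ _ [].
- by move=> /andP[/eqP xd _] _ [xd' _]; case: xd.
- by move=> _ /andP[/eqP xd _] [xd' _]; case: xd.
by move=> /andP[_ xp] /andP[_ xu] [_ /IH]; apply.
Qed.

Lemma cat_cons_injr (A : eqType) (x : A) (p q u v : seq A) :
  x \notin q -> x \notin v -> u ++ x :: v = p ++ x :: q -> u = p.
Proof.
move=> xq xv E; apply: (can_inj revK).
apply: (@cat_cons_injl _ x (rev q) (rev p) (rev v) (rev u)); rewrite ?mem_rev //.
by rewrite -!cat_rcons -!rev_cons -!rev_cat E.
Qed.

(** * An SCM grammar comparing two bit strings *)

Section CopyGrammar.
Variables (T : finType) (I : eqType) (items : seq I).
Variables (left : I -> seq (T + bool)) (right : I -> seq bool) (stop : seq bool).
(** Nonempty codes on both sides ensure that an insertion surrounds its [symS] with symbols other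
    than [symS] and [symY]. *)
Hypothesis left_neq0 : forall i, i \in items -> left i <> [::].
Hypothesis right_neq0 : forall i, i \in items -> right i <> [::].

Definition copy_nt : finType := option (option bool).
Local Notation sym := (T + copy_nt)%type.
Definition symS : sym := inr None.
Definition symY : sym := inr (Some None).
Definition bit (b : bool) : sym := inr (Some (Some b)).
Definition emb (x : T + bool) : sym :=
  match x with inl a => inl a | inr b => bit b end.

Definition item_matrix i : scm_matrix T copy_nt :=
  SCMMatrix [:: (None, map emb (left i) ++ symS :: map bit (rev (right i)))]
    None None.
Definition stop_matrix : scm_matrix T copy_nt :=
  SCMMatrix [:: (None, rcons (map bit stop) symY)] None (Some [:: symY]).
(** The two marked bits may stand anywhere. That they were the neighbours of [symY] is enforced only
    later, by the context of [erase_matrix]; forbidding [symS] makes them the only two [symS] at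
    that moment. *)
Definition mark_matrix b : scm_matrix T copy_nt :=
  SCMMatrix (nseq 2 (Some (Some b), [:: symS])) (Some [:: symY]) (Some [:: symS]).
Definition erase_matrix : scm_matrix T copy_nt :=
  SCMMatrix (nseq 2 (None, [::])) (Some [:: symS; symY; symS]) None.
Definition finish_matrix : scm_matrix T copy_nt :=
  SCMMatrix [:: (Some None, [::])] None (Some [:: symS]).

Definition copy_grammar : scm_grammar T copy_nt := SCMGrammar None
  (map item_matrix items ++ [:: stop_matrix; mark_matrix true; mark_matrix false;
     erase_matrix; finish_matrix]).

Inductive copy_step (x y : seq sym) : Prop :=
  | CopyItem i u v of i \in items & x = u ++ symS :: v
      & y = u ++ (map emb (left i) ++ symS :: map bit (rev (right i))) ++ v
  | CopyStop u v of symY \notin x & x = u ++ symS :: v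
      & y = u ++ map bit stop ++ symY :: v
  | CopyMark b z of symY \in x & symS \notin x
      & rewrite_one (Some (Some b)) [:: symS] x z
      & rewrite_one (Some (Some b)) [:: symS] z y
  | CopyErase z of infix [:: symS; symY; symS] x
      & rewrite_one None [::] x z & rewrite_one None [::] z y
  | CopyFinish u v of symS \notin x & x = u ++ symY :: v & y = u ++ v.

Lemma copy_stepP x y : scm_step copy_grammar x y <-> copy_step x y.
Proof.
split=> [[r [rG rxy]] | ].
  case: (List.in_app_or _ _ _ rG) rxy => {rG} [|rG].
    case/List.in_map_iff=> i [<- /In_mem iI] [_ [_ [z [[u [v [xE zE]]] <-]]]].
    exact: CopyItem iI xE zE.
  case: rG => [<-|[<-|[<-|[<-|[<-|//]]]]] [/= P [F]].
  + case=> z [[u [v [xE zE]]] <-]; apply: (CopyStop _ xE).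
      by rewrite -infix1s F.
    by rewrite zE cat_rcons.
  + case=> z [xz [z' [zz' <-]]]; apply: CopyMark xz zz'.
      by rewrite -infix1s P.
    by rewrite -infix1s F.
  + case=> z [xz [z' [zz' <-]]]; apply: CopyMark xz zz'.
      by rewrite -infix1s P.
    by rewrite -infix1s F.
  + by case=> z [xz [z' [zz' <-]]]; apply: CopyErase xz zz'; apply: P.
  + case=> z [[u [v [xE zE]]] <-]; apply: (CopyFinish _ xE zE).
    by rewrite -infix1s F.
have inG r : List.In r [:: stop_matrix; mark_matrix true; mark_matrix false;
    erase_matrix; finish_matrix] -> List.In r (scm_matrices copy_grammar).
  by move=> rG; apply: List.in_or_app; right.
case=> [i u v iI xE yE|u v Yx xE yE|b z Yx Sx xz zy|z P xz zy|u v Sx xE yE].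
- eexists; split.
    apply: List.in_or_app; left; apply: List.in_map; apply/In_mem; exact: iI.
  by split=> //; split=> //; exists y; split=> //; exists u, v.
- exists stop_matrix; split; first by apply: inG => /=; tauto.
  split=> //; split=> [f [<-]|]; first by rewrite infix1s.
  by exists y; split=> //; exists u, v; rewrite cat_rcons.
- exists (mark_matrix b); split; first by apply: inG; case: b {xz zy} => /=; tauto.
  split=> [f [<-]|]; first by rewrite infix1s.
  split=> [f [<-]|]; first by rewrite infix1s.
  by exists z; split=> //; exists y.
- exists erase_matrix; split; first by apply: inG => /=; tauto.
  split=> [f [<-]|] //; split=> //.
  by exists z; split=> //; exists y.
exists finish_matrix; split; first by apply: inG => /=; tauto.
split=> //; split=> [f [<-]|]; first by rewrite infix1s.
by exists y; split=> //; exists u, v.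
Qed.

(** The bits [q] are stored reversed, so the neighbours of the central symbol are the last symbols
    of [p] and [q]: cancellation compares the two strings from their ends. *)
Definition growing p (q : seq bool) := map emb p ++ symS :: map bit (rev q).
Definition shrinking p (q : seq bool) := map emb p ++ symY :: map bit (rev q).

(** * Occurrences of the central symbols and the effect of rewriting on them *)

Lemma count_emb (A : copy_nt) p :
  (if A is Some (Some _) then false else true) ->
  count_mem (inr A : sym) (map emb p) = 0.
Proof.
move=> hA; apply/count_memPn; apply/negP => /mapP[[a|b] _] //=.
by case=> AE; rewrite AE in hA.
Qed.

Lemma count_bit (A : copy_nt) s :
  (if A is Some (Some _) then false else true) ->
  count_mem (inr A : sym) (map bit s) = 0.
Proof.
move=> hA; apply/count_memPn; apply/negP => /mapP[b _ [AE]].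
by rewrite AE in hA.
Qed.

Lemma emb_inj : injective emb.
Proof. by move=> [a|b] [c|d] //= [->]. Qed.

Lemma infix_count2 (P Q x : seq sym) :
  count_mem symS x = 2 -> x = P ++ [:: symS; symY; symS] ++ Q ->
  symS \notin P /\ symS \notin Q.
Proof.
move=> + xE; rewrite xE !count_cat /= => cE; split; apply/count_memPn; move: cE;
  by move: (count_mem _ P) (count_mem _ Q) => m n; lia.
Qed.

(* An insertion at one of two [S] yields neighbours [e], [f] that block erasing. *)
Lemma unframed (u v P Q : seq sym) e f :
  e != symS -> e != symY -> f != symS -> f != symY ->
  count_mem symS (u ++ e :: symS :: f :: v) = 2 ->
  u ++ e :: symS :: f :: v <> P ++ [:: symS; symY; symS] ++ Q.
Proof.
move=> eS eY fS fY c2 E; have [SP SQ] := infix_count2 c2 E.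
move: c2; rewrite count_cat /= (negPf eS) (negPf fS) !add0n => c2.
have [Su|Su] := boolP (symS \in u).
  have Sv : symS \notin v.
    apply/count_memPn; move: Su c2; rewrite -has_pred1 has_count.
    by move: (count _ u) (count _ v) => m n; lia.
  have : rcons u e = rcons (rcons P symS) symY.
    apply: (@cat_cons_injr _ symS _ Q _ (f :: v)); rewrite ?cat_rcons //.
    by rewrite in_cons negb_or eq_sym fS.
  by case/rcons_inj=> _ eYE; rewrite eYE eqxx in eY.
suff [fYE _] : f :: v = symY :: symS :: Q by rewrite fYE eqxx in fY.
apply: (@cat_cons_injl _ symS P _ (rcons u e)); rewrite ?cat_rcons //.
by rewrite mem_rcons in_cons negb_or eq_sym eS.
Qed.

Lemma filter_rewrite_nil x y : rewrite_one None [::] x y ->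
  filter (predC1 symS) y = filter (predC1 symS) x.
Proof. by case=> u [v [-> ->]]; rewrite !filter_cat. Qed.

Lemma count_rewrite a (A : copy_nt) (s x y : seq sym) : rewrite_one A s x y ->
  count a y + a (inr A) = count a x + count a s.
Proof. by case=> u [v [-> ->]]; rewrite !count_cat /=; lia. Qed.

(** If bits [b] of a word without [symS] have been marked, every [symS] stems from a [b], and this
    map recovers the original word. *)
Definition unmark b (s : sym) := if s == symS then bit b else s.

Lemma map_unmark_rewrite b (x y : seq sym) :
  rewrite_one (Some (Some b)) [:: symS] x y -> map (unmark b) y = map (unmark b) x.
Proof. by case=> u [v [-> ->]]; rewrite !map_cat. Qed.

Lemma map_unmark_id b (s : seq sym) : symS \notin s -> map (unmark b) s = s.
Proof.
move=> Ss; rewrite -[RHS]map_id; apply/eq_in_map => c cs.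
by rewrite /unmark; case: eqP => // cS; rewrite -cS cs in Ss.
Qed.

(** Every matrix rewrites [symS] or [symY] or requires [symY] as a context. *)
Lemma star_inert x y : star (scm_step copy_grammar) x y ->
  symS \notin x -> symY \notin x -> y = x.
Proof.
case=> {x y} // x y z xy _ Sx Yx.
have absent (a : sym) u v : a \notin x -> x <> u ++ a :: v.
  by move=> ax E; case/negP: ax; rewrite E mem_cat mem_head orbT.
case/copy_stepP: xy => [i u v _ /(absent _ _ _ Sx) //|u v _ /(absent _ _ _ Sx) //
  |b z'|z' /mem_infix Px|u v _ /(absent _ _ _ Yx) //].
  by rewrite (negPf Yx).
by case/negP: Yx; apply: Px; rewrite !inE eqxx orbT.
Qed.

(** Induction backwards from the terminal word, for the three phases at once. The phase between
    marking and erasing is described by counts alone, because insertions at a marked [symS] preserve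
    the counts; that no such insertion took place is part of the conclusion. *)
Lemma copy_sound_forms w x : star (scm_step copy_grammar) x (map inl w) ->
  [/\ forall p q, x = growing p q -> exists2 its, {subset its <= items} &
        p ++ flatten (map left its) ++ map inr stop =
          map inl w ++ map inr (q ++ flatten (map right its)),
      forall p q, x = shrinking p q -> p = map inl w ++ map inr q
    & count_mem symS x = 2 -> count_mem symY x = 1 ->
      exists P Q, x = P ++ [:: symS; symY; symS] ++ Q /\
        forall p q, P ++ symY :: Q = shrinking p q -> p = map inl w ++ map inr q].
Proof.
have emb_terminal s : map inl s = map emb (map inl s) by rewrite -map_comp.
move Ey: (map inl w) => y xy; elim: xy Ey => {x y} [x|x y z xy yz IH] Ey.
  have cx A : (if A is Some (Some _) then false else true) ->
      count_mem (inr A : sym) x = 0.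
    by move=> hA; rewrite -Ey emb_terminal count_emb.
  split=> [p q xE|p q xE|]; last by rewrite cx.
    by exfalso; move: (cx None isT); rewrite xE count_cat /=; lia.
  by exfalso; move: (cx (Some None) isT); rewrite xE count_cat /=; lia.
have {IH} [IHg IHs IHd] := IH Ey.
split.
- move=> p q xE.
  have cY : count_mem symY x = 0 by rewrite xE count_cat /= count_emb // count_bit.
  have nS s : ~~ has (pred1 symS) (map emb s) by rewrite has_pred1; apply/count_memPn/count_emb.
  have nS' s : ~~ has (pred1 symS) (map bit s) by rewrite has_pred1; apply/count_memPn/count_bit.
  have YnotX : symY \notin x by apply/count_memPn.
  have splitS u v : x = u ++ symS :: v -> u = map emb p /\ v = map bit (rev q).
    rewrite xE => /esym/(cat_cons_uniq (a := pred1 symS)) H.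
    by have [] := H (nS _) (nS' _) (eqxx _).
  move/copy_stepP: xy; case=> [i u v iI|u v _|b z' Yx|z' /mem_infix Px|u v _].
  + move=> /splitS[-> ->] yE.
    have [|its itsI E] := IHg (p ++ left i) (q ++ right i).
      by rewrite yE /growing rev_cat !map_cat -!catA.
    exists (i :: its); last by rewrite /= !catA -[in RHS]catA in E *.
    by move=> j; rewrite in_cons => /predU1P[->|/itsI].
  + move=> /splitS[-> ->] yE; exists [::] => //=.
    rewrite cats0; apply: IHs.
    by rewrite yE /shrinking map_cat -catA -map_comp.
  + by rewrite (negPf YnotX) in Yx.
  + by case/negP: YnotX; apply: Px; rewrite !inE eqxx orbT.
  by move=> xE'; case/negP: YnotX; rewrite xE' mem_cat mem_head orbT.
- move=> p q xE.
  have cS : count_mem symS x = 0 by rewrite xE count_cat /= count_emb // count_bit.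
  have cY : count_mem symY x = 1 by rewrite xE count_cat /= count_emb // count_bit.
  have SnotX : symS \notin x by apply/count_memPn.
  have nY s : ~~ has (pred1 symY) (map emb s) by rewrite has_pred1; apply/count_memPn/count_emb.
  have nY' s : ~~ has (pred1 symY) (map bit s) by rewrite has_pred1; apply/count_memPn/count_bit.
  have badS u v : x <> u ++ symS :: v.
    by move=> E; case/negP: SnotX; rewrite E mem_cat mem_head orbT.
  move/copy_stepP: xy; case=> [i u v _ /badS //|u v _ /badS //|b z' _ _ xz zy
    |z' /mem_infix Sx|u v _ xE' yE].
  + have c2 : count_mem symS y = 2.
      by have := count_rewrite (pred1 symS) xz; have := count_rewrite (pred1 symS) zy;
        rewrite /= cS; lia.
    have c1 : count_mem symY y = 1.
      by have := count_rewrite (pred1 symY) xz; have := count_rewrite (pred1 symY) zy;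
        rewrite /= cY; lia.
    have [P [Q [yE PQ]]] := IHd c2 c1.
    have [SP SQ] := infix_count2 c2 yE.
    (* Unmarking [y] gives back [x], so the frame [S Y S] of [y] lies over [b Y b] in [x]. As [x]
       has a single [symY], both [p] and [q] end in [b]. *)
    have E : map (unmark b) y = map (unmark b) x.
      by rewrite (map_unmark_rewrite zy) (map_unmark_rewrite xz).
    move: E; rewrite (map_unmark_id _ SnotX) xE yE !map_cat.
    rewrite (map_unmark_id _ SP) (map_unmark_id _ SQ) /unmark /= -cat_rcons.
    case/(cat_cons_uniq (nY p) (nY' (rev q)) (eqxx _)).
    case: (lastP p) => [|p1 a]; first by case: (P).
    rewrite map_rcons => /rcons_inj[PE aE] _.
    case Eq: (rev q) => [|b' q2] //= [b'E QE].
    have {aE} -> : a = inr b by case: a aE => // c [->].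
    have -> : q = rcons (rev q2) b by rewrite b'E -rev_cons -Eq revK.
    by rewrite (PQ p1 (rev q2)) /shrinking ?revK ?PE ?QE // map_rcons rcons_cat.
  + by case/negP: SnotX; apply: Sx; rewrite !inE eqxx.
  move: xE'; rewrite xE => /esym.
  case/(cat_cons_uniq (nY p) (nY' (rev q)) (eqxx _)) => uE _ vE.
  have yE2 : y = map emb (p ++ map inr (rev q)).
    by rewrite yE uE vE map_cat -map_comp.
  (* Without [symS] and [symY] the word can no longer change, so it is already terminal. A bit left
     over from [q] would be a nonterminal. *)
  have : map emb (map inl w) = map emb (p ++ map inr (rev q)).
    rewrite -yE2 -emb_terminal Ey; apply: star_inert yz _ _; apply/count_memPn;
    by rewrite yE2 count_emb.
  move/(inj_map emb_inj); case Eq: (rev q) => [|b r] E; last first.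
    have : (inr b : T + bool) \in map inl w by rewrite E mem_cat mem_head orbT.
    by case/mapP.
  by rewrite E -[q]revK Eq !cats0.
- move=> c2 c1.
  move/copy_stepP: xy; case=> [i u v iI xE yE|u v Yx|b z' _ Sx|z' /infixP[P [Q xE]] xz zy|u v Sx].
  + have c2' : count_mem symS y = 2.
      by rewrite -c2 xE yE !count_cat /= count_emb //= count_bit.
    have c1' : count_mem symY y = 1.
      by rewrite -c1 xE yE !count_cat /= count_emb //= count_bit.
    (* The insertion keeps both counts, so [y] would contain the frame. But its [symS] now stands
       between the last symbol of [left i] and the last bit of [right i], which [unframed]
       excludes. *)
    have [P [Q [yE' _]]] := IHd c2' c1'; exfalso.
    case: (lastP (left i)) (left_neq0 iI) yE => // l a _.
    case: (lastP (right i)) (right_neq0 iI) => // r b _.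
    rewrite map_rcons rev_rcons /= -!catA cat_rcons /= catA => yE.
    rewrite yE in c2' yE'; case: (unframed _ _ _ _ c2' yE') => //; by case: (a).
  + by move: Yx; rewrite -has_pred1 has_count c1.
  + by move: Sx; rewrite -has_pred1 has_count c2.
  (* Exactly two [symS] are present and two are erased, so [y] is [x] without any [symS], that is
     [P ++ symY :: Q]. *)
  + exists P, Q; split=> // p q PQ; apply: IHs; rewrite -PQ.
    have [SP SQ] := infix_count2 c2 xE.
    have c0 : count_mem symS y = 0.
      by have := count_rewrite (pred1 symS) xz; have := count_rewrite (pred1 symS) zy;
        rewrite /= c2; lia.
    have fid s : count_mem symS s = 0 -> filter (predC1 symS) s = s.
      move=> s0; apply/all_filterP; rewrite all_predC has_pred1.
      exact/count_memPn.
    rewrite -[y]fid // (filter_rewrite_nil zy) (filter_rewrite_nil xz) xE.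
    by rewrite !filter_cat /= !fid //; apply/count_memPn.
  by move: Sx; rewrite -has_pred1 has_count c2.
Qed.

(** * Derivations of the comparing grammar *)

Lemma grow its p q : {subset its <= items} ->
  star (scm_step copy_grammar) (growing p q)
    (growing (p ++ flatten (map left its)) (q ++ flatten (map right its))).
Proof.
elim: its p q => [|i its IH] p q itsI; first by rewrite !cats0; apply: star_refl.
have iI : i \in items by apply: itsI; rewrite mem_head.
rewrite /= !catA; apply: star_step (IH _ _ _) => [|j jI]; last first.
  by apply: itsI; rewrite in_cons jI orbT.
apply/copy_stepP/(CopyItem (i := i) iI) => //.
by rewrite /growing rev_cat !map_cat -!catA.
Qed.

Lemma shrink p q : star (scm_step copy_grammar)
  (shrinking (p ++ map inr q) q) (shrinking p [::]).
Proof.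
elim/last_ind: q => [|q b IH]; first by rewrite cats0; apply: star_refl.
pose P := map emb (p ++ map inr q); pose Q := map bit (rev q).
have -> : shrinking (p ++ map inr (rcons q b)) (rcons q b) =
    P ++ [:: bit b; symY; bit b] ++ Q.
  by rewrite /shrinking rev_rcons /P /Q !map_cat map_rcons map_rcons -!catA cat_rcons.
have Y x y : symY \in x ++ [:: y, symY & Q] by rewrite mem_cat !inE eqxx !orbT.
apply: (@star_step _ _ _ (P ++ [:: symS; symY; symS] ++ Q)).
  apply/copy_stepP/(CopyMark (b := b) (z := P ++ [:: symS; symY; bit b] ++ Q)).
  - by rewrite mem_cat !inE eqxx !orbT.
  - by apply/count_memPn; rewrite !count_cat /= count_emb // count_bit.
  - by exists P, ([:: symY; bit b] ++ Q).
  by exists (P ++ [:: symS; symY]), Q; rewrite -!catA.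
apply: star_step IH.
apply/copy_stepP/(CopyErase (z := P ++ [:: symY; symS] ++ Q)).
- exact: infix_infix.
- by exists P, ([:: symY; symS] ++ Q).
by exists (P ++ [:: symY]), Q; rewrite -!catA.
Qed.

Lemma copy_generates w :
  scm_generates copy_grammar w <-> exists2 its, {subset its <= items} &
    flatten (map left its) ++ map inr stop =
      map inl w ++ map inr (flatten (map right its)).
Proof.
(* The start word is the growing form with [p] and [q] empty. *)
split=> [/copy_sound_forms[/(_ [::] [::] erefl) //]|[its itsI E]].
apply: (star_trans (grow [::] [::] itsI)); rewrite /=.
set p := flatten _ in E *; set q := flatten _ in E *.
apply: (@star_step _ _ _ (shrinking (map inl w ++ map inr q) q)).
  apply/copy_stepP/CopyStop; last 1 first.
  - by rewrite -E /shrinking map_cat -catA -map_comp.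
  - by apply/count_memPn; rewrite count_cat /= count_emb // count_bit.
  by [].
apply: (star_trans (shrink _ _)); apply: star1; apply/copy_stepP/CopyFinish => //.
  by apply/count_memPn; rewrite count_cat /= count_emb.
by rewrite cats0 -map_comp.
Qed.

(** The bounds hold with room: the grammar has degree (3,1) and five conditional matrices, of which
    only the two marking ones are non-simple. *)
Lemma SCM_copy (L : seq T -> Prop) :
  (forall w, L w <-> exists2 its, {subset its <= items} &
    flatten (map left its) ++ map inr stop =
      map inl w ++ map inr (flatten (map right its))) ->
  SCM 5 2 4 7 2 4 L.
Proof.
move=> LE; exists copy_nt, copy_grammar.
have controlP r : List.In r (scm_matrices copy_grammar) ->
    (exists i, r = item_matrix i) \/ List.In r [:: stop_matrix; mark_matrix true;
      mark_matrix false; erase_matrix; finish_matrix].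
  move=> rG; case: (List.in_app_or _ _ _ rG) => [|?]; last by right.
  by case/List.in_map_iff=> i [<- _]; left; exists i.
split.
- split; last by rewrite !card_option card_bool.
  move=> r /controlP[[i ->]|[<-|[<-|[<-|[<-|[<-|//]]]]]];
    by split=> //; split=> // f [<-].
- by move=> r /controlP[[i ->]|[<-|[<-|[<-|[<-|[<-|//]]]]]].
- rewrite count_cat count_map (eq_count (a2 := pred0)) ?count_pred0 //.
- rewrite count_cat count_map (eq_count (a2 := pred0)) ?count_pred0 //.
by move=> w; rewrite LE copy_generates.
Qed.

End CopyGrammar.

(** * Bit codes of tiles *)

Section TileItems.
Variables (T N : finType) (G : ps_grammar T N).
Local Notation sym := (T + N)%type.
Local Notation start := (inr (ps_start G) : sym).
Local Notation tile := (tile T N).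

(* [inr None] emits the marker [$].  The left codes are shifted by one bit with
   respect to the right ones, and [inr None] emits the missing bit: this forces it
   to be used exactly once, after all letters and before all tiles. *)
Definition item : Type := (T + option tile)%type.
Notation Letter a := (inl a : item).
Notation Tile t := (inr (Some t) : item).

Definition tile_items : seq item :=
  map inl (enum T) ++ map inr (None :: map Some (tiles G)).

(* The number 0 is reserved for what [inr None] emits on the left. *)
Definition num (s : option sym) : nat := (enum_rank s).+1.

Definition item_read (o : option tile) : seq nat :=
  if o is Some t then map num (read t) else [:: 0].
Definition item_written (o : option tile) : seq nat :=
  if o is Some t then map num (written t) else [:: num None].

Definition item_left (i : item) : seq (T + bool) :=
  match i with inl a => [:: inl a] | inr o => map inr (dcode (item_read o)) end.
Definition item_right (i : item) : seq bool :=
  ccode (match i with inl a => [:: num (Some (inl a))] | inr o => item_written o end).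
(** This is the code of the final queue [start $] without its last bit; appending [false] to both
    sides of the equation completes it and turns [ccode] into a shifted [dcode]. *)
Definition item_stop : seq bool :=
  rcons (nseq (num (Some start)) true) false ++ nseq (num None) true.

Lemma num_inj : injective num.
Proof. by move=> s t [] /ord_inj /enum_rank_inj. Qed.

Lemma item_stopE : rcons item_stop false = dcode [:: num (Some start); num None].
Proof. by rewrite /item_stop rcons_cat /dcode /= cats0. Qed.

Lemma rcons_neq_nil (A : Type) (s : seq A) x : rcons s x <> [::].
Proof. by case: s. Qed.

Lemma dcode_read o : exists b s, dcode (item_read o) = b :: s.
Proof.
case: o => [[lr c]|] /=; last by exists false, [::].
rewrite /read; case: rcons (@rcons_neq_nil _ (map Some lr.2) c) => // s t _ /=.
by exists true; rewrite /dcode /=; eexists.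
Qed.

Lemma item_left_neq0 i : i \in tile_items -> item_left i <> [::].
Proof. by case: i => //= o _; have [b [s ->]] := dcode_read o. Qed.

Lemma item_right_neq0 i : i \in tile_items -> item_right i <> [::].
Proof.
case: i => //= -[[lr c]|] _ //; rewrite /item_right /= /written.
by case: rcons (@rcons_neq_nil _ (map Some lr.1) c).
Qed.

Lemma left_options os :
  flatten (map item_left (map inr os)) = map inr (dcode (flatten (map item_read os))).
Proof. by elim: os => //= o os ->; rewrite dcode_cat map_cat. Qed.

Lemma right_options os :
  flatten (map item_right (map inr os)) = ccode (flatten (map item_written os)).
Proof. by elim: os => //= o os ->; rewrite ccode_cat. Qed.

Lemma no_letter its z :
  flatten (map item_left its) ++ map inr item_stop = map inr z :> seq (T + bool) ->
  exists os, its = map inr os.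
Proof.
elim: its z => [|[a|o] its IH] z /=; first by exists [::].
  by case: z.
move=> E; have [|os ->] := IH (drop (size (dcode (item_read o))) z).
  rewrite map_drop -E -catA drop_size_cat // size_map //.
by exists (o :: os).
Qed.

(** A letter item emits a terminal, which can only match a letter of [w], and [w] precedes all bits.
    So the letter items come first and spell [w]. The accumulator [q] collects the right codes of
    those already passed. *)
Lemma letters_first its w q :
  flatten (map item_left its) ++ map inr item_stop =
    map inl w ++ map inr (q ++ flatten (map item_right its)) ->
  exists os, [/\ {subset map inr os <= its} &
    dcode (flatten (map item_read os)) ++ item_stop =
    q ++ ccode (map num (map (Some \o inl) w) ++ flatten (map item_written os))].
Proof.
elim: its w q => [|[a|o] its IH] w q.
- case: w => [|b w] // E; exists [::]; split=> //.
  exact: (inj_map (@inr_inj _ _) E).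
- case: w => [|b w] E; first by move: E => /=; case: (q ++ _).
  have ab : a = b by case: E.
  have /IH[os [osI {}E]] : flatten (map item_left its) ++ map inr item_stop =
      map inl w ++ map inr ((q ++ item_right (inl a)) ++ flatten (map item_right its)).
    by rewrite -catA; case: E.
  exists os; split; first by move=> i /osI; rewrite in_cons orbC => ->.
  by rewrite E -catA -ccode_cat -ab.
(* The left code of a non-letter item starts with a bit, so [w] is used up. *)
case: w => [|a w]; last by have [b [s Eo]] := dcode_read o; rewrite /= Eo.
move=> E; have [os osE] := @no_letter (inr o :: its) _ E.
exists os; rewrite -osE; split=> //; move: E.
rewrite osE left_options right_options -map_cat => E.
exact: (inj_map (@inr_inj _ _) E).
Qed.

Lemma no_turn os : 0 \notin flatten (map item_read os) -> exists ts, os = map Some ts.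
Proof.
elim: os => [|[t|] os IH] /=; first by exists [::].
  by rewrite mem_cat negb_or => /andP[_ /IH[ts ->]]; exists (t :: ts).
by [].

Qed.

Lemma flatten_item_read ts :
  flatten (map item_read (map Some ts)) = map num (flatten (map read ts)).
Proof. by elim: ts => //= t ts ->; rewrite map_cat. Qed.

Lemma flatten_item_written ts :
  flatten (map item_written (map Some ts)) = map num (flatten (map written ts)).
Proof. by elim: ts => //= t ts ->; rewrite map_cat. Qed.

Lemma num_neq0 s : 0 \notin map num s.
Proof. by apply/negP => /mapP[]. Qed.

Lemma written_neq0 os : 0 \notin flatten (map item_written os).
Proof.
elim: os => //= o os IH; rewrite mem_cat negb_or IH andbT.
by case: o => [t|]; rewrite ?num_neq0.
Qed.

Lemma mem_tile_items t : (Tile t \in tile_items) = (t \in tiles G).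
Proof.
rewrite mem_cat; have -> : (Tile t \in map inl (enum T)) = false by apply/mapP=> -[].
by rewrite orFb mem_map ?in_cons ?mem_map // => [x y []|x y []].
Qed.

Lemma items_generate w :
  (exists2 its, {subset its <= tile_items} &
    flatten (map item_left its) ++ map inr item_stop =
      map inl w ++ map inr (flatten (map item_right its))) <->
  star (ps_step G) [:: start] (map inl w).
Proof.
split=> [[its itsI E]|/tiles_complete[ts tsG E]].
  have [os [osI {}E]] := @letters_first _ _ [::] E.
  (* The missing last bit is restored on both sides, after which both are [dcode] words and can be
     decoded. *)
  have : dcode (flatten (map item_read os) ++ [:: num (Some start); num None]) =
      dcode (0 :: map num (map (Some \o inl) w) ++ flatten (map item_written os)).
    by rewrite -ccode_shift -[RHS]/(rcons ([::] ++ _) _) -E dcode_cat -item_stopE rcons_cat.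
  (* The right side starts with 0, while every symbol read by a tile has a positive number: the
     first option must be [None]. *)
  move/dcode_inj; case: os osI {E} => [|[t|] os] osI //=.
    by rewrite /read; case: t {osI} => [[l [|c r]] d].
  case=> E; have os0 : 0 \notin flatten (map item_read os).
    apply/negP => z0; have : 0 \in flatten (map item_read os) ++
      [:: num (Some start); num None] by rewrite mem_cat z0.
    rewrite E mem_cat in_cons (negPf (num_neq0 _)) /=.
    by rewrite (negPf (written_neq0 _)).
  have [ts osE] := no_turn os0; rewrite osE in E osI.
  rewrite -[map inl w]/([::] ++ map inl w); apply: (@tiles_sound _ _ G ts _ [::]).
    move=> t tts; rewrite -mem_tile_items; apply/itsI/osI/map_f.
    by rewrite in_cons map_f.
  apply: (inj_map num_inj); rewrite !map_cat -flatten_item_read /= E.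
  by rewrite flatten_item_written -!map_comp.
exists (map inl w ++ map inr (None :: map Some ts)).
  move=> i; rewrite mem_cat => /orP[/mapP[a _ ->]|].
    by rewrite mem_cat map_f // mem_enum.
  rewrite inE => /orP[/eqP->|/mapP[_ /mapP[t tts ->] ->]].
    by rewrite mem_cat map_f ?mem_head // orbT.
  by rewrite mem_tile_items tsG.
rewrite (map_cat item_left) (map_cat item_right) !flatten_cat left_options right_options.
have -> : flatten (map item_left (map inl w)) = map inl w by elim: (w) => //= a s ->.
have -> : flatten (map item_right (map inl w)) = ccode (map num (map (Some \o inl) w)).
  elim: (w) => // a s IH.
  rewrite -[LHS]/(item_right (Letter a) ++ flatten (map item_right (map inl s))).
  by rewrite IH -ccode_cat.
rewrite -catA -map_cat -ccode_cat; congr (_ ++ map inr _).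
apply: (@rcons_injl _ false); rewrite ccode_shift rcons_cat item_stopE -dcode_cat /=.
rewrite flatten_item_read flatten_item_written; congr (dcode (0 :: _)).
rewrite -[[:: num _; _]]/(map num [:: Some start; None]) -map_cat -E.
by rewrite map_cat map_rcons cat_rcons map_comp.
Qed.

End TileItems.

Lemma RE_SCM (T : finType) (L : seq T -> Prop) : RE L -> SCM 5 2 4 7 2 4 L.
Proof.
case=> N [G [_ LG]].
apply: (SCM_copy (@item_left_neq0 _ _ G) (@item_right_neq0 _ _ G)).
by move=> w; apply: (iff_trans (LG w)); apply: iff_sym; apply: items_generate.
Qed.

(** * Type-0 grammars for SCM languages *)

Section AnyNonterminals.
Variables (T : finType) (N : eqType) (S : N).
Variable rules : seq (seq (T + N) * seq (T + N)).

Definition rules_step (x y : seq (T + N)) : Prop :=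
  exists u v l r, (l, r) \in rules /\ x = u ++ l ++ v /\ y = u ++ r ++ v.

Let nonterminals (x : seq (T + N)) : seq N :=
  pmap (fun s => if s is inr A then Some A else None) x.
Let used : seq N :=
  flatten [seq nonterminals lr.1 ++ nonterminals lr.2 | lr <- rules].
Let N' : finType := 'I_(size used).+1.
(** A nonterminal outside [S :: used] falls on the default index 0 of [inord], shared with [S]. *)
Let shrink_nt (A : N) : N' := inord (index A (S :: used)).
Let unshrink_nt (i : N') : N := nth S (S :: used) i.
Let lift_nt (A B : Type) (f : A -> B) (s : T + A) : T + B :=
  match s with inl a => inl a | inr A => inr (f A) end.

Lemma shrink_ntK A : A \in S :: used -> unshrink_nt (shrink_nt A) = A.
Proof.
move=> Au; rewrite /unshrink_nt inordK ?nth_index //.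
by rewrite ltnS -[_ <= _]/(_ < size (S :: used)) index_mem.
Qed.

Lemma shrink_rules l r : (l, r) \in rules ->
  map (lift_nt unshrink_nt) (map (lift_nt shrink_nt) l) = l /\
  map (lift_nt unshrink_nt) (map (lift_nt shrink_nt) r) = r.
Proof.
move=> lr.
have fixed x : {subset nonterminals x <= used} ->
    map (lift_nt unshrink_nt) (map (lift_nt shrink_nt) x) = x.
  elim: x => //= -[a|A] x IH xu /=; first by rewrite IH.
  rewrite shrink_ntK ?IH //; first by move=> B Bx; apply: xu; rewrite in_cons Bx orbT.
  by rewrite in_cons xu ?orbT // mem_head.
split; apply: fixed => A Ax; apply/flattenP;
  exists (nonterminals l ++ nonterminals r); rewrite ?mem_cat ?Ax ?orbT //;
  exact: (map_f (fun lr => nonterminals lr.1 ++ nonterminals lr.2) lr).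
Qed.

(** Finitely many rules mention finitely many nonterminals. Renaming maps derivations forward, and
    it is undone on both sides of every rule, so derivations map back as well. *)
Lemma RE_rules (L : seq T -> Prop) :
  (forall lr, lr \in rules -> has (fun s : T + N => if s is inr _ then true else false) lr.1) ->
  (forall w, L w <-> star rules_step [:: inr S] (map inl w)) -> RE L.
Proof.
move=> wf LE; pose shr := map (lift_nt shrink_nt); pose unshr := map (lift_nt unshrink_nt).
exists N', (PSGrammar (shrink_nt S) [seq (shr lr.1, shr lr.2) | lr <- rules]); split.
  move=> _ /mapP[lr /wf lrE ->]; rewrite has_map; apply: sub_has lrE.
  by case.
have lift_inl A B (f : A -> B) w : map (lift_nt f) (map inl w) = map inl w.
  by rewrite -map_comp.
pose G' := PSGrammar (shrink_nt S) [seq (shr lr.1, shr lr.2) | lr <- rules].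
move=> w; rewrite LE; split.
  suff H x y : star rules_step x y -> star (ps_step G') (shr x) (shr y).
    by move/H; rewrite /shr lift_inl.
  elim=> [{}x|{}x {}y z [u [v [l [r [lr [-> ->]]]]]] _]; first exact: star_refl.
  apply: star_step; exists (shr u), (shr v), (shr l), (shr r).
  by rewrite /shr !map_cat; split=> //; apply/mapP; exists (l, r).
have /= Sfix := shrink_ntK (mem_head S used).
suff H x y : star (ps_step G') x y -> star rules_step (unshr x) (unshr y).
  by move/H; rewrite /unshr lift_inl /= Sfix.
elim=> [{}x|{}x {}y z [u [v [l [r [/mapP[lr lrE [-> ->]] [-> ->]]]]]] _].
  exact: star_refl.
apply: star_step; exists (unshr u), (unshr v), lr.1, lr.2.
case: lr lrE => l' r' lrE; have [lE rE] := shrink_rules lrE.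
by rewrite /unshr /shr !map_cat /= lE rE.
Qed.

End AnyNonterminals.

(** * Simulating an SCM grammar with a single moving head *)

Section Simulation.
Variables (T N : finType) (G : scm_grammar T N).
Local Notation sym := (T + N)%type.

Inductive task := Need of seq sym | Avoid of seq sym | Rewrite of N & seq sym.

Definition task_code t : (seq sym + seq sym) + N * seq sym :=
  match t with
  | Need p => inl (inl p) | Avoid f => inl (inr f) | Rewrite A x => inr (A, x)
  end.
Definition task_decode c :=
  match c with
  | inl (inl p) => Need p | inl (inr f) => Avoid f | inr (A, x) => Rewrite A x
  end.
Lemma task_codeK : cancel task_code task_decode. Proof. by case. Qed.
HB.instance Definition _ := Equality.copy task (can_type task_codeK).

Definition task_rel t (x y : seq sym) : Prop :=
  match t with
  | Need p => infix p x /\ x = y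
  | Avoid f => ~~ infix f x /\ x = y
  | Rewrite A s => rewrite_one A s x y
  end.

Fixpoint tasks_rel ts (x y : seq sym) : Prop :=
  if ts is t :: ts' then exists z, task_rel t x z /\ tasks_rel ts' z y else x = y.

(** The tests come before all rewriting, since both contexts concern the word to which the matrix is
    applied. *)
Definition matrix_tasks (r : scm_matrix T N) : seq task :=
  oapp (fun p => [:: Need p]) [::] (mx_permit r) ++
  oapp (fun f => [:: Avoid f]) [::] (mx_forbid r) ++
  [seq Rewrite Ax.1 Ax.2 | Ax <- mx_rules r].

Lemma matrix_tasksE r x y : tasks_rel (matrix_tasks r) x y <-> scm_apply r x y.
Proof.
case: r => rs P F; rewrite /matrix_tasks /scm_apply /=.
have rsE z : tasks_rel [seq Rewrite Ax.1 Ax.2 | Ax <- rs] z y <-> apply_rules rs z y.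
  elim: rs z => // -[A s] rs IH z /=.
  by split=> -[z' [zz' /IH]]; exists z'.
have FE z : tasks_rel (oapp (fun f => [:: Avoid f]) [::] F ++
      [seq Rewrite Ax.1 Ax.2 | Ax <- rs]) z y <->
    (forall f, F = Some f -> ~~ infix f z) /\ apply_rules rs z y.
  case: F => [f|] /=; last by rewrite rsE; split=> [|[]].
  split=> [[_ [[fz <-] /rsE]]|[fz /rsE zy]]; last by exists z; split; first by split=> //; apply: fz.
  by split=> // _ [<-].
case: P => [p|] /=; last by rewrite FE; split=> [|[]].
split=> [[_ [[pz <-] /FE]]|[pz /FE zy]]; last by exists x; split; first by split=> //; apply: pz.
by split=> // _ [<-].
Qed.

(* A sentential form of the simulating grammar keeps the current word between
   [Lend] and [Rend], with exactly one head in it; [Run ts] has to perform [ts]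
   next, and [Scan f ts] has checked that no occurrence of [f] starts on its left. *)
Inductive head_nt :=
  | Plain of N | Start | Lend | Rend | Fin
  | Run of seq task | Scan of seq sym & seq task.

Definition head_code h : (N + nat) + (seq task + seq sym * seq task) :=
  match h with
  | Plain A => inl (inl A)
  | Start => inl (inr 0) | Lend => inl (inr 1)
  | Rend => inl (inr 2) | Fin => inl (inr 3)
  | Run ts => inr (inl ts) | Scan f ts => inr (inr (f, ts))
  end.
Definition head_decode c :=
  match c with
  | inl (inl A) => Plain A
  | inl (inr i) => nth Start [:: Start; Lend; Rend; Fin] i
  | inr (inl ts) => Run ts | inr (inr (f, ts)) => Scan f ts
  end.
Lemma head_codeK : cancel head_code head_decode. Proof. by case. Qed.
HB.instance Definition _ := Equality.copy head_nt (can_type head_codeK).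

Local Notation letter := (T + head_nt)%type.

Definition is_head (s : letter) : bool :=
  match s with
  | inl _ | inr (Plain _) | inr Lend | inr Rend => false
  | _ => true
  end.

Definition plain (s : sym) : letter :=
  match s with inl a => inl a | inr A => inr (Plain A) end.

Definition progs : seq (seq task) := map matrix_tasks (scm_matrices G).
(* Locked, since [mem_cat] would unfold it in membership in [sim_rules]. *)
Definition states : seq (seq task) :=
  locked ([::] :: [seq drop k ts | ts <- progs, k <- iota 0 (size ts).+1]).

Lemma states_behead t ts : t :: ts \in states -> ts \in states.
Proof.
rewrite /states -lock in_cons => /orP[//|/allpairsPdep[ts' [k [ts'P kP E]]]].
rewrite in_cons; apply/orP; right; apply/allpairsPdep; exists ts', k.+1.
have kl : k < size ts'.
  by rewrite ltnNge; apply/negP => sk; rewrite drop_oversize in E.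
split=> //; first by rewrite mem_iota.
by have := congr1 (drop 1) E; rewrite drop_drop /= drop0.
Qed.

Lemma progs_states ts : ts \in progs -> ts \in states.
Proof.
move=> tsP; rewrite /states -lock in_cons; apply/orP; right.
by apply/allpairsPdep; exists ts, 0; rewrite drop0 mem_iota.
Qed.

Definition words k : seq (seq sym) := map val (enum {: k.-tuple sym}).

Lemma mem_words k s : (s \in words k) = (size s == k).
Proof.
apply/mapP/eqP => [[t _ ->]|<-]; first by rewrite size_tuple.
by exists (in_tuple s); rewrite ?mem_enum.
Qed.

(** A scan starts at [Lend]; a window of length [size f] other than [f] lets the head advance by one
    symbol, and fewer than [size f] symbols before [Rend] end the scan. For empty [f] a scan can
    neither advance nor end, as it should, the empty word being a factor of every word. *)
Definition task_rules (ts : seq task) : seq (seq letter * seq letter) :=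
  match ts with
  | [::] => [::]
  | Need p :: ts' => [:: (inr (Run ts) :: map plain p, inr (Run ts') :: map plain p)]
  | Rewrite A x :: ts' => [:: ([:: inr (Run ts); plain (inr A)], inr (Run ts') :: map plain x)]
  | Avoid f :: ts' =>
    ([:: inr Lend; inr (Run ts)], [:: inr Lend; inr (Scan f ts')]) ::
    [seq (inr (Scan f ts') :: map plain s,
          take 1 (map plain s) ++ inr (Scan f ts') :: drop 1 (map plain s))
       | s <- words (size f) & s != f] ++
    [seq (inr (Scan f ts') :: rcons (map plain s) (inr Rend),
          inr (Run ts') :: rcons (map plain s) (inr Rend))
       | k <- iota 0 (size f), s <- words k]
  end.

Definition sim_rules : seq (seq letter * seq letter) :=
  [:: ([:: inr Start], [:: inr Lend; inr (Run [::]); plain (inr (scm_start G)); inr Rend]);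
      ([:: inr Lend; inr (Run [::])], [:: inr Fin]);
      ([:: inr Fin; inr Rend], [::])] ++
  [seq ([:: inr Fin; inl a], [:: inl a; inr Fin]) | a <- enum T] ++
  [seq ([:: inr (Run [::])], [:: inr (Run ts)]) | ts <- progs] ++
  [seq ([:: inr (Run ts); plain s], [:: plain s; inr (Run ts)])
     | ts <- states, s <- enum {: sym}] ++
  [seq ([:: plain s; inr (Run ts)], [:: inr (Run ts); plain s])
     | ts <- states, s <- enum {: sym}] ++
  flatten (map task_rules states).

(** Each left-hand side is split at its only head, so that the head of a sentential form determines
    where a rule applies. *)
Inductive sim_rule : seq letter -> head_nt -> seq letter -> seq letter -> Prop :=
  | SimStart : sim_rule [::] Start [::]
      [:: inr Lend; inr (Run [::]); plain (inr (scm_start G)); inr Rend]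
  | SimExit : sim_rule [:: inr Lend] (Run [::]) [::] [:: inr Fin]
  | SimEnd : sim_rule [::] Fin [:: inr Rend] [::]
  | SimFin a : sim_rule [::] Fin [:: inl a] [:: inl a; inr Fin]
  | SimBegin ts of ts \in progs : sim_rule [::] (Run [::]) [::] [:: inr (Run ts)]
  | SimRight ts s of ts \in states :
      sim_rule [::] (Run ts) [:: plain s] [:: plain s; inr (Run ts)]
  | SimLeft ts s of ts \in states :
      sim_rule [:: plain s] (Run ts) [::] [:: inr (Run ts); plain s]
  | SimNeed p ts of Need p :: ts \in states :
      sim_rule [::] (Run (Need p :: ts)) (map plain p) (inr (Run ts) :: map plain p)
  | SimRewrite A x ts of Rewrite A x :: ts \in states :
      sim_rule [::] (Run (Rewrite A x :: ts)) [:: plain (inr A)]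
        (inr (Run ts) :: map plain x)
  | SimAvoid f ts of Avoid f :: ts \in states :
      sim_rule [:: inr Lend] (Run (Avoid f :: ts)) [::] [:: inr Lend; inr (Scan f ts)]
  | SimScan f ts s of Avoid f :: ts \in states & size s = size f & s != f :
      sim_rule [::] (Scan f ts) (map plain s)
        (take 1 (map plain s) ++ inr (Scan f ts) :: drop 1 (map plain s))
  | SimDone f ts s of Avoid f :: ts \in states & size s < size f :
      sim_rule [::] (Scan f ts) (rcons (map plain s) (inr Rend))
        (inr (Run ts) :: rcons (map plain s) (inr Rend)).

Lemma sim_rulesP l r : (l, r) \in sim_rules <->
  exists lc h rc, sim_rule lc h rc r /\ l = lc ++ inr h :: rc.
Proof.
split.
- rewrite !mem_cat => /or4P[|/mapP[a _ [-> ->]]|/mapP[ts tsP [-> ->]]|].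
  + rewrite !inE => /or3P[] /eqP[-> ->]; [exists [::]|exists [:: inr Lend]|exists [::]];
    by do 2!eexists; split; [constructor|].
  + by exists [::]; do 2!eexists; split; [apply: SimFin|].
  + by exists [::]; do 2!eexists; split; [apply: SimBegin tsP|].
  case/or3P=> [/allpairsP[[ts s] /= [tsP _ [-> ->]]]
      |/allpairsP[[ts s] /= [tsP _ [-> ->]]]|/flattenP[_ /mapP[ts tsP ->]]].
  + by exists [::]; do 2!eexists; split; [apply: SimRight tsP|].
  + by exists [:: plain s]; do 2!eexists; split; [apply: SimLeft tsP|].
  case: ts tsP => [|[p|f|A x] ts] tsP //=.
  + by rewrite inE => /eqP[-> ->]; exists [::]; do 2!eexists; split; [apply: SimNeed tsP|].
  + rewrite in_cons mem_cat => /or3P[/eqP[-> ->]|/mapP[s + [-> ->]]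
        |/allpairsPdep[k [s [kf sk [-> ->]]]]].
    * by exists [:: inr Lend]; do 2!eexists; split; [apply: SimAvoid tsP|].
    * rewrite mem_filter mem_words => /andP[sf /eqP ss].
      by exists [::]; do 2!eexists; split; [apply: SimScan|].
    move: kf sk; rewrite mem_iota mem_words add0n leq0n => kf /eqP sk; rewrite -sk in kf.
    by exists [::]; do 2!eexists; split; [apply: SimDone tsP kf|].
  by rewrite inE => /eqP[-> ->]; exists [::]; do 2!eexists; split; [apply: SimRewrite tsP|].
case=> lc [h [rc [hr ->]]].
have inT ts lr : ts \in states -> lr \in task_rules ts -> lr \in sim_rules.
  move=> tsP lrE; rewrite !mem_cat; do 5!(apply/orP; right).
  by apply/flattenP; exists (task_rules ts) => //; apply: map_f.
case: hr => {lc h rc r} [||| a|ts tsP|ts s tsP|ts s tsP|p ts tsP|A x ts tsP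
  |f ts tsP|f ts s tsP ss sf|f ts s tsP ss].
- by rewrite mem_cat !in_cons eqxx.
- by rewrite mem_cat !in_cons eqxx !orbT.
- by rewrite mem_cat !in_cons eqxx !orbT.
- rewrite !mem_cat; apply/orP; right; apply/orP; left; apply/mapP; exists a => //.
  by rewrite mem_enum.
- rewrite !mem_cat; do 2!(apply/orP; right); apply/orP; left.
  by apply/mapP; exists ts.
- rewrite !mem_cat; do 3!(apply/orP; right); apply/orP; left.
  by apply/allpairsP; exists (ts, s); rewrite mem_enum.
- rewrite !mem_cat; do 4!(apply/orP; right); apply/orP; left.
  by apply/allpairsP; exists (ts, s); rewrite mem_enum.
- by apply: inT tsP _; rewrite mem_head.
- by apply: inT tsP _; rewrite mem_head.
- by apply: inT tsP _; rewrite mem_head.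
- apply: inT tsP _; rewrite /= in_cons mem_cat; apply/or3P/Or32/mapP; exists s => //.
  by rewrite mem_filter sf mem_words ss eqxx.
apply: inT tsP _; rewrite /= in_cons mem_cat; apply/or3P/Or33/allpairsPdep.
by exists (size s), s; rewrite mem_iota mem_words eqxx.
Qed.

Definition config u h v : seq letter :=
  (inr Lend :: map plain u) ++ inr h :: rcons (map plain v) (inr Rend).
(** The left marker is gone, and the exit head passes over terminals only; it disappears together
    with [Rend], so a nonterminal still in [v] blocks it. *)
Definition final u v : seq letter :=
  map inl u ++ inr Fin :: rcons (map plain v) (inr Rend).

Local Notation sim_step := (rules_step sim_rules).

(** * Soundness of the simulation *)

Lemma sim_rule_head lc h rc r : sim_rule lc h rc r -> is_head (inr h).
Proof. by case. Qed.

Lemma plain_inj : injective plain.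
Proof. by move=> [a|A] [b|B] //= [->]. Qed.

Lemma headless_plain s : ~~ has is_head (map plain s).
Proof. by rewrite has_map; apply/hasPn => -[]. Qed.

Lemma headless_rcons s : ~~ has is_head (rcons (map plain s) (inr Rend)).
Proof. by rewrite has_rcons /= headless_plain. Qed.

Lemma headless_inl u : ~~ has is_head (map inl u).
Proof. by rewrite has_map; apply/hasPn. Qed.

(** The head of the rule has to coincide with the only head of the word, which leaves no choice for
    the factorization. *)
Lemma sim_step_inv A h B y : ~~ has is_head A -> ~~ has is_head B ->
  sim_step (A ++ inr h :: B) y -> exists a lc rc b r,
    [/\ sim_rule lc h rc r, A = a ++ lc, B = rc ++ b & y = a ++ r ++ b].
Proof.
move=> hA hB [a [b [l [r [/sim_rulesP[lc [h' [rc [hr ->]]]] [E ->]]]]]].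
have {}E : (a ++ lc) ++ inr h' :: (rc ++ b) = A ++ inr h :: B by rewrite E -!catA.
have [aE [hE] bE] := cat_cons_uniq hA hB (sim_rule_head hr) E.
rewrite -hE -aE -bE.
by exists a, lc, rc, b, r.
Qed.

Lemma headless_stuck x y : ~~ has is_head x -> star sim_step x y -> x = y.
Proof.
move=> hx xy; case: xy hx => {x y} // x z y [a [b [l [r [/sim_rulesP + [-> _]]]]]] _.
case=> lc [h [rc [/sim_rule_head hh ->]]].
by rewrite -catA /= !has_cat /= -/(is_head (inr h)) hh !orbT.
Qed.

Lemma plain_prefix v s b : rcons (map plain v) (inr Rend) = map plain s ++ b ->
  exists2 v', v = s ++ v' & b = rcons (map plain v') (inr Rend).
Proof.
elim: s v => [|c s IH] [|d v] /=; try by move=> <-; eexists.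
  by case: c.
by case=> /plain_inj -> /IH[v' -> ->]; exists v'.
Qed.

Lemma plain_all v s b :
  rcons (map plain v) (inr Rend) = rcons (map plain s) (inr Rend) ++ b ->
  v = s /\ b = [::].
Proof.
elim: s v => [|c s IH] [|d v] //=; first by case.
- by case: d.
- by case: c.
by case=> /plain_inj -> /IH[-> ->].
Qed.

Lemma Lend_all u a : inr Lend :: map plain u = a ++ [:: inr Lend] ->
  u = [::] /\ a = [::].
Proof.
case: (lastP u) => [|u' c]; first by case: a => [|x []].
by rewrite map_rcons -rcons_cons cats1 => /rcons_inj[_]; case: c.
Qed.

Lemma Lend_last u a s : inr Lend :: map plain u = a ++ [:: plain s] ->
  exists2 u', u = rcons u' s & a = inr Lend :: map plain u'.
Proof.
case: (lastP u) => [|u' c]; rewrite ?map_rcons -?rcons_cons cats1.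
  by rewrite -[[:: _]]/(rcons [::] _) => /rcons_inj[_]; case: s.
by case/rcons_inj=> <- /plain_inj ->; exists u'.
Qed.

(** Induction backwards from the terminal word, over all shapes of a sentential form. For [Run] only
    the word [u ++ v] matters, not the position of the head; for [Scan] the part [v] is what remains
    to be checked. *)
Lemma sim_sound w x : star sim_step x (map inl w) ->
  [/\ forall u ts v, x = config u (Run ts) v -> exists y,
        tasks_rel ts (u ++ v) y /\ star (scm_step G) y (map inl w),
      forall u f ts v, x = config u (Scan f ts) v -> ~~ infix f v /\ exists y,
        tasks_rel ts (u ++ v) y /\ star (scm_step G) y (map inl w),
      forall u v, x = final u v -> map inl u ++ v = map inl w
    & x = [:: inr Start] -> scm_generates G w].
Proof.
move Ey: (map inl w) => y xy; elim: xy Ey => {x y} [x|x y z xy yz IH] Ew.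
  have hx : ~~ has is_head x by rewrite -Ew headless_inl.
  have bad A h B : is_head (inr h) -> x <> A ++ inr h :: B.
    by move=> hh xE; move: hx; rewrite xE has_cat /= -/(is_head (inr h)) hh orbT.
  by split=> [u ts v /bad|u f ts v /bad|u v /bad|/(bad [::])] H; case: H.
have {IH} [IHr IHs IHf _] := IH Ew.
have hL u : ~~ has is_head (inr Lend :: map plain u) by rewrite /= headless_plain.
split.
- move=> u ts v xE; move: xy; rewrite xE.
  case/(sim_step_inv (hL u) (headless_rcons v)) => a [lc [rc [b [r [hr]]]]].
  move: hr; move Eh: (Run ts) => h hr.
  case: hr Eh => {lc h rc r} // [[->]|ts0 ts0P [->]|_ s _ [<-]|_ s _ [<-]
    |p ts0 _ [->]|A s ts0 _ [->]|f ts0 _ [->]].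
  + case/Lend_all=> -> -> /= bE yE; exists v; split=> //.
    by rewrite -(IHf [::] v); [apply: star_refl|rewrite yE /final bE].
  + rewrite cats0 => aE bE yE; exists (u ++ v); split=> //.
    have [|y' [tsy y'w]] := IHr u ts0 v; first by rewrite yE -aE /config bE.
    apply: star_step y'w; case/In_mem/List.in_map_iff: ts0P => r' [rE r'G].
    by exists r'; split=> //; apply/matrix_tasksE; rewrite rE.
  + rewrite cats0 -[[:: plain s]]/(map plain [:: s]) => aE /plain_prefix[v' -> bE] yE.
    rewrite catA cats1; apply: IHr.
    by rewrite yE bE -aE /config map_rcons -rcons_cons cat_rcons.
  + case/Lend_last=> u' -> -> /= bE yE; rewrite cat_rcons; apply: IHr.
    by rewrite yE /config /= bE.
  + rewrite cats0 => aE /plain_prefix[v' vE bE] yE.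
    have [|y' [tsy y'w]] := IHr u ts0 v.
      by rewrite yE -aE bE vE /config map_cat rcons_cat.
    exists y'; split=> //; exists (u ++ v); split=> //; split=> //.
    by rewrite vE infix_infix.
  + rewrite cats0 -[[:: plain _]]/(map plain [:: inr A]).
    move=> aE /plain_prefix[v' vE bE] yE.
    have [|y' [tsy y'w]] := IHr u ts0 (s ++ v').
      by rewrite yE -aE bE /config map_cat rcons_cat.
    exists y'; split=> //; exists (u ++ s ++ v'); split=> //.
    by exists u, v'; rewrite vE.
  case/Lend_all=> -> -> /= bE yE.
  have [|fv [y' [tsy y'w]]] := IHs [::] f ts0 v; first by rewrite yE /config bE.
  by exists y'; split=> //; exists v.
- move=> u f ts v xE; move: xy; rewrite xE.
  case/(sim_step_inv (hL u) (headless_rcons v)) => a [lc [rc [b [r [hr]]]]].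
  move: hr; move Eh: (Scan f ts) => h hr.
  case: hr Eh => {lc h rc r} // [f' ts' s _ ss sf [fE tsE]|f' ts' s _ ss [fE tsE]].
    rewrite cats0 => aE /plain_prefix[v' -> bE] yE.
    (* An empty window would mean that [f] is empty too, against [s != f]. *)
    case: s ss sf yE => [|c s] ss sf yE.
      by move: ss sf; case: (f').
    have [|fv [y' [tsy y'w]]] := IHs (rcons u c) f ts (s ++ v').
      rewrite yE -aE bE /config /= take0 drop0 map_rcons map_cat rcons_cat fE tsE.
      by rewrite cat_rcons -catA.
    split; last by exists y'; rewrite -cat_rcons.
    (* An occurrence of [f] starts at [c] or lies further right. The former is excluded by the
       window, which has the length of [f] and differs from it. *)
    rewrite -[infix _ _]/(prefix f (c :: s ++ v') || infix f (s ++ v')).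
    by rewrite negb_or fv andbT fE -cat_cons prefixE -ss take_size_cat.
  rewrite cats0 => aE /plain_all[-> ->] yE; split.
    by apply/negP => /size_infix; rewrite leqNgt fE ss.
  by apply: IHr; rewrite yE -aE tsE cats0.
- move=> u v xE; move: xy; rewrite xE.
  case/(sim_step_inv (headless_inl u) (headless_rcons v)) => a [lc [rc [b [r [hr]]]]].
  move: hr; move Eh: Fin => h hr.
  case: hr Eh => {lc h rc r} // [_|c _].
    (* The symbol to the right of [Fin] is [Rend], so [v] is empty and the word that remains has no
       head. *)
    rewrite cats0 => aE; case: v {xE} => [[<-]|[c|A] v] //= yE.
    have yu : y = map inl u by rewrite yE aE !cats0.
    have E : map inl u = map inl w :> seq letter.
      by rewrite Ew -yu; apply: headless_stuck yz; rewrite yu headless_inl.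
    by rewrite (inj_map (@inl_inj _ _) E) cats0.
  rewrite cats0 -[[:: inl c]]/(map plain [:: inl c]) => aE /plain_prefix[v' -> bE] yE.
  rewrite -(IHf (rcons u c) v') ?map_rcons ?cat_rcons //.
  by rewrite yE -aE bE /final map_rcons cat_rcons.
move=> xE; move: xy; rewrite xE -[[:: _]]/([::] ++ _).
case/(@sim_step_inv [::] _ [::]) => // a [lc [rc [b [r [hr]]]]].
move: hr; move Eh: Start => h hr; case: hr Eh => // _.
case: a => // _ /= <- yE.
by have [|y' [<- y'w]] := IHr [::] [::] [:: inr (scm_start G)].
Qed.

(** * Completeness of the simulation *)

Lemma sim_step_rule lc h rc r a b x y : sim_rule lc h rc r ->
  x = a ++ lc ++ inr h :: rc ++ b -> y = a ++ r ++ b -> sim_step x y.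
Proof.
move=> hr -> ->; exists a, b, (lc ++ inr h :: rc), r; rewrite -catA.
by split=> //; apply/sim_rulesP; exists lc, h, rc.
Qed.

Lemma config_rcons u s h v :
  config (rcons u s) h v = (inr Lend :: map plain u) ++
    [:: plain s; inr h] ++ rcons (map plain v) (inr Rend).
Proof. by rewrite /config map_rcons -rcons_cons cat_rcons. Qed.

Lemma run_left ts u v : ts \in states ->
  star sim_step (config u (Run ts) v) (config [::] (Run ts) (u ++ v)).
Proof.
move=> tsP; elim/last_ind: u v => [|u s IH] v; first exact: star_refl.
rewrite cat_rcons; apply: star_step (IH _).
by apply: (sim_step_rule (SimLeft s tsP)); rewrite ?config_rcons.
Qed.

Lemma run_right ts u v : ts \in states ->
  star sim_step (config [::] (Run ts) (u ++ v)) (config u (Run ts) v).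
Proof.
move=> tsP; elim/last_ind: u v => [|u s IH] v; first exact: star_refl.
rewrite cat_rcons; apply: star_trans (IH _) _; apply: star1.
apply: (sim_step_rule (a := inr Lend :: map plain u) (SimRight s tsP)) => //.
by rewrite config_rcons.
Qed.

(** The scan stops as soon as fewer than [size f] symbols are left, so the final position of the
    head is only asserted to exist. *)
Lemma run_scan f ts u v : Avoid f :: ts \in states -> ~~ infix f v ->
  exists u' v', u' ++ v' = u ++ v /\
    star sim_step (config u (Scan f ts) v) (config u' (Run ts) v').
Proof.
move=> tsP; elim: v u => [|c v IH] u fv.
  exists u, [::]; split=> //; apply: star1.
  apply: (sim_step_rule (a := inr Lend :: map plain u) (b := [::])
    (SimDone (s := [::]) tsP _)); rewrite ?cats0 //.
  by rewrite lt0n size_eq0; apply: contra fv => /eqP ->.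
have [cf|fc] := ltnP (size (c :: v)) (size f).
  exists u, (c :: v); split=> //; apply: star1.
  by apply: (sim_step_rule (a := inr Lend :: map plain u) (b := [::])
    (SimDone tsP cf)); rewrite ?cats0.
have {fv} [pf fv] : ~~ prefix f (c :: v) /\ ~~ infix f v.
  by apply/andP; rewrite -negb_or.
have [u' [v' [E run]]] := IH (rcons u c) fv.
exists u', v'; split; first by rewrite E cat_rcons.
apply: star_step run.
have f0 : 0 < size f by rewrite lt0n size_eq0; apply: contra pf => /eqP ->.
(* The window consists of the next [size f] symbols; it is nonempty, since the empty [f] would be a
   prefix. *)
set s := take (size f) (c :: v).
have sE : s = c :: take (size f).-1 v by rewrite /s; case: (f) f0.
have vE : c :: v = s ++ drop (size f) (c :: v) by rewrite cat_take_drop.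
apply: (sim_step_rule (a := inr Lend :: map plain u)
  (b := rcons (map plain (drop (size f) (c :: v))) (inr Rend))
  (SimScan (s := s) tsP _ _)); first by rewrite size_takel.
- by rewrite -prefixE.
- by rewrite {1}vE /config map_cat rcons_cat.
have {}vE : v = take (size f).-1 v ++ drop (size f) (c :: v).
  by case: (f) f0 => //= d g _; rewrite cat_take_drop.
by rewrite config_rcons [in LHS]vE sE map_cat rcons_cat; case: (take _ v).
Qed.

(** Every task starts with the head at the left end and is followed by a walk back there, where the
    next scan or the exit can begin. *)
Lemma run_tasks ts x y : ts \in states -> tasks_rel ts x y ->
  star sim_step (config [::] (Run ts) x) (config [::] (Run [::]) y).
Proof.
elim: ts x => [|t ts IH] x tsP /=; first by move=> ->; apply: star_refl.
have ts'P := states_behead tsP.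
case=> z [xz /(IH _ ts'P)]; apply: star_trans.
case: t tsP xz => [p|f|A s] tsP /=.
- case=> /infixP[u [v ->]] <-.
  apply: (star_trans (run_right u _ tsP)); apply: star_trans (run_left u _ ts'P).
  by apply: star1; apply: (sim_step_rule (a := inr Lend :: map plain u) (SimNeed tsP));
    rewrite /config map_cat rcons_cat.
- case=> fx <-; have [u [v [/= <- run]]] := run_scan [::] tsP fx.
  apply: star_trans (run_left u v ts'P); apply: star_step run.
  exact: (sim_step_rule (a := [::]) (SimAvoid tsP)).
case=> u [v [-> ->]].
apply: (star_trans (run_right u _ tsP)); apply: star_trans (run_left u _ ts'P).
apply: star1; apply: (sim_step_rule (a := inr Lend :: map plain u) (SimRewrite tsP)) => //.
by rewrite /config map_cat rcons_cat.
Qed.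

Lemma sim_complete w : scm_generates G w -> star sim_step [:: inr Start] (map inl w).
Proof.
move=> Gw; apply: (@star_step _ _ _ (config [::] (Run [::]) [:: inr (scm_start G)])).
  by apply: (sim_step_rule (a := [::]) (b := [::]) SimStart).
apply: (@star_trans _ _ _ (config [::] (Run [::]) (map inl w))).
  elim: Gw => [x|x y z [r [rG xy]] _]; first exact: star_refl.
  have rP : matrix_tasks r \in progs.
    by apply/In_mem/List.in_map.
  apply: star_trans; apply: star_step (run_tasks (progs_states rP) _).
    by apply: (sim_step_rule (a := [:: inr Lend]) (SimBegin rP)).
  exact/matrix_tasksE.
apply: (@star_step _ _ _ (final [::] (map inl w))).
  by apply: (sim_step_rule (a := [::]) SimExit).
suff H u v : star sim_step (final u (map inl v)) (map inl (u ++ v)).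
  exact: (H [::] w).
elim: v u => [|c v IH] u.
  apply: star1; apply: (sim_step_rule (a := map inl u) (b := [::]) SimEnd) => //.
  by rewrite !cats0.
rewrite -cat_rcons; apply: star_step (IH _).
apply: (sim_step_rule (a := map inl u) (SimFin c)) => //.
by rewrite /final map_rcons cat_rcons.
Qed.

Lemma SCM_RE_grammar (L : seq T -> Prop) :
  (forall w, L w <-> scm_generates G w) -> RE L.
Proof.
move=> LG; apply: (@RE_rules _ _ Start sim_rules) => [[l r]|w].
  case/sim_rulesP=> lc [h [rc [_ ->]]] /=.
  by rewrite has_cat /= orbT.
by rewrite LG; split=> [/sim_complete //|/sim_sound[_ _ _]]; apply.
Qed.

End Simulation.

Theorem mainTheorem5 (T : finType) (L : seq T -> Prop) :
  SCM 5 2 4 7 2 4 L <-> RE L.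
Proof.
split=> [[N [G [_ _ _ _ LG]]]|]; first exact: SCM_RE_grammar LG.
exact: RE_SCM.
Qed.
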